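(* Let $b\ge 2$ be an integer and let $B_b$ be the set of integers $m$ such that $m(m+1)\equiv b(b-1)/2 \pmod{b-1}$. If $n$ is an integer such that $n(n+1)$ is a strict pandigital number in base $b$ or a strict penholodigital number in base $b$, then $n\equiv m\pmod{b-1}$ for some $m\in B_b$.
   Context: Numbers are written in base $b$ without leading zeros, with digits $0,1,\dots,b-1$. A positive integer $N$ is a strict pandigital number in base $b$ if its base-$b$ representation contains each of the $b$ digits $0,1,\dots,b-1$ exactly once. $N$ is a strict penholodigital number in base $b$ if its base-$b$ representation does not contain the digit $0$ and contains each of the $b-1$ nonzero digits $1,\dots,b-1$ exactly once. *)

(* Defs.v *)
From mathcomp Require Import all_boot all_order all_algebra.

Set Implicit Arguments.
Unset Strict Implicit.
Unset Printing Implicit Defensive.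

Import Order.TTheory GRing.Theory Num.Theory.
Local Open Scope ring_scope.

(* Digit sequences are written most significant digit first. *)
Definition base_value (b : nat) (s : seq nat) : nat :=
  foldl (fun acc d => acc * b + d)%N 0%N s.

(* The default 0 of [head] makes the last condition exclude the empty
   sequence as well as leading zeros, so only positive N are represented. *)
Definition base_repr (b : nat) (N : int) (s : seq nat) : Prop :=
  [/\ N = (base_value b s)%:Z,
      forall d : nat, d \in s -> (d < b)%N
    & head 0%N s != 0%N].

Definition strict_pandigital (b : nat) (N : int) : Prop :=
  0 < N /\
  exists2 s : seq nat, base_repr b N s &
    forall d : nat, (d < b)%N -> count_mem d s = 1%N.

Definition strict_penholodigital (b : nat) (N : int) : Prop :=
  0 < N /\
  exists2 s : seq nat, base_repr b N s &
    0%N \notin s /\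
    (forall d : nat, (0 < d < b)%N -> count_mem d s = 1%N).

(* The division by 2 is exact. *)
Definition B (b : nat) : {pred int} :=
  [pred m : int | (m * (m + 1) == ((b%:Z * (b%:Z - 1)) %/ 2)%Z
                     %[mod (b%:Z - 1)])%Z].

(* Main.v *)
Require Import Defs.
From mathcomp Require Import all_boot all_order all_algebra.

Set Implicit Arguments.
Unset Strict Implicit.
Unset Printing Implicit Defensive.

Import Order.TTheory GRing.Theory Num.Theory.
Local Open Scope ring_scope.

(* Casting out b - 1: since b = 1 modulo b - 1, a number is congruent to the
   sum of its digits, here 0 + 1 + ... + (b - 1) = b (b - 1) / 2 in both cases
   because an absent digit 0 does not change the sum. Hence n itself lies in
   B b. *)

Lemma base_value_modn (c : nat) (s : seq nat) :
  (base_value c.+1 s = sumn s %[mod c])%N.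
Proof.
(* The added 0 matches the initial accumulator of [foldl], so the induction can generalize both to
   [acc]. *)
rewrite /base_value -[sumn s]add0n.
elim: s 0%N => [|d s IHs] acc /=; first by rewrite addn0.
by rewrite IHs mulnS (addnC acc) -!addnA modnMDl.
Qed.

Lemma sumn_all_digits (b : nat) (s : seq nat) :
  (forall d, d \in s -> (d < b)%N) ->
  (forall d, (d < b)%N -> count_mem d s = 1%N) -> sumn s = 'C(b, 2).
Proof.
move=> s_lt s_count.
suff /perm_sumn -> : perm_eq s (iota 0 b)
  by rewrite sumnE -bin2_sum /index_iota subn0.
(* [perm_eq] compares counts only at entries of [s ++ iota 0 b], all of which are below [b]. *)
apply/allP => d; rewrite mem_cat mem_iota add0n /= => d_in.
have d_lt : (d < b)%N by case/orP: d_in => // /s_lt.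
by rewrite s_count // count_uniq_mem ?iota_uniq // mem_iota add0n d_lt.
Qed.

Lemma base_repr_modz (b : nat) (N : int) (s : seq nat) :
  (0 < b)%N -> base_repr b N s -> sumn s = 'C(b, 2) ->
  (N = ((b%:Z * (b%:Z - 1)) %/ 2)%Z %[mod (b%:Z - 1)])%Z.
Proof.
(* With [b = c.+1] the modulus is the natural number [c], so the congruence descends from [int] to
   [nat]. *)
case: b => // c _ [-> _ _] sum_s.
have -> : c.+1%:Z - 1 = c%:Z by rewrite -addn1 PoszD addrK.
by rewrite -PoszM divz_nat !modz_nat base_value_modn sum_s bin2 divn2.
Qed.

Theorem theorem3 (b : nat) (hb : (2 <= b)%N) (n : int)
  (hn : strict_pandigital b (n * (n + 1)) \/
        strict_penholodigital b (n * (n + 1))) :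
  exists2 m : int, m \in B b & (n = m %[mod (b%:Z - 1)])%Z.
Proof.
exists n => //; rewrite inE; apply/eqP.
have b_gt0 : (0 < b)%N by exact: ltnW.
case: hn => [[_ [s repr_s s_count]]|[_ [s repr_s [s0 s_count]]]];
  apply: (base_repr_modz b_gt0 repr_s); have [_ s_lt _] := repr_s.
  exact: sumn_all_digits.
(* Prepending 0 leaves the sum unchanged by conversion and supplies the only missing digit. *)
rewrite -[sumn s]/(sumn (0%N :: s)); apply: sumn_all_digits => d.
  by rewrite inE => /predU1P[->|/s_lt].
case: d => [|d] d_lt /=; last by rewrite s_count.
by rewrite (count_memPn s0).
Qed.
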